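(* Let $H$ be a strongly primary Puiseux monoid. 1. The following statements are equivalent. (a) $H$ is finitely generated. (b) $H$ is isomorphic to a numerical monoid. (c) $H$ is Mori with $(H : \widehat H) \ne \emptyset$. (d) $H$ is finitely primary. (e) $\widehat H$ is Krull. (f) $\widehat H$ is atomic. (g) $\widehat H$ is strongly primary. (h) $\widehat H \cong (\mathbb N_0, +)$. 2. For a prime $p$ let $A_p = \{u \in \mathcal A(H) : p \mid \mathsf d(u)\}$. The set $A_p$ is finite and non-empty only for finitely many primes $p$. In particular, $H$ is isomorphic to a Puiseux monoid $H^\ast$ with the additional property that, for every prime $p$, the set $A_p^\ast = \{u \in \mathcal A(H^\ast) : p \mid \mathsf d(u)\}$ is either empty or infinite.
   Context: A monoid is a commutative cancellative semigroup with identity element. The general notions below are written multiplicatively; for Puiseux monoids they are read additively. For a monoid $H$: $H^\times$ is the group of invertible elements, $\mathsf q(H)$ the quotient group, $\mathcal A(H)$ the set of atoms (non-invertible elements that are not a product of two non-invertible elements). $H$ is atomic if every non-invertible element is a finite product of atoms. The complete integral closure is $\widehat H = \{x \in \mathsf q(H) : \text{there is } c \in H \text{ with } cx^n \in H \text{ for all } n \in \mathbb N\}$, where $\mathbb N$ is the set of positive integers; $H$ is completely integrally closed if $H = \widehat H$. The conductor is $(H : \widehat H) = \{x \in \mathsf q(H) : x\widehat H \subset H\}$. A subset $I \subset H$ is a divisorial ideal if $I = (I^{-1})^{-1}$, where $X^{-1} = \{z \in \mathsf q(H) : zX \subset H\}$ for $X \subset \mathsf q(H)$. $H$ is Mori if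 it satisfies the ascending chain condition on divisorial ideals, and Krull if it is Mori and completely integrally closed. $H$ is primary if $H \ne H^\times$ and for all $a,b \in H \setminus H^\times$ there is $n \in \mathbb N$ with $b^n \in aH$. $H$ is strongly primary if $H \neq H^\times$ and for each $a \in H\setminus H^\times$ there is $n \in \mathbb N$ with $(H \setminus H^\times)^n \subset aH$ (where $X^n$ is the set of all products of $n$ elements of $X$). $H$ is finitely primary if there are $s,\alpha \in \mathbb N$ such that $H$ is a submonoid of a factorial monoid $F = F^\times \times \mathcal F(\{p_1,\dots,p_s\})$, with $\mathcal F(\{p_1, \dots, p_s\})$ the free commutative monoid with basis consisting of $s$ distinct elements $p_1,\dots,p_s$, satisfying $H \setminus H^\times \subset p_1\cdots p_s F$ and $(p_1 \cdots p_s)^\alpha F \subset H$. A Puiseux monoid is a submonoid of $(\mathbb Q_{\ge 0}, +)$. A numerical monoid is a submonoid of $(\mathbb N_0,+)$ with finite complement in $\mathbb N_0$. For $x \in \mathbb Q$, $\mathsf d(x)\ge 1$ denotes the denominator of $x$ written in lowest terms. *)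

(* Defs.v *)
From mathcomp Require Import all_boot all_order all_algebra.
From mathcomp Require Import boolp classical_sets functions cardinality.

Set Implicit Arguments.
Unset Strict Implicit.
Unset Printing Implicit Defensive.

Import GRing.Theory Num.Theory.
Local Open Scope classical_set_scope.
Local Open Scope ring_scope.

(* Monoids are written additively and are given as submonoids of an ambient
   commutative monoid.  Notions that involve the quotient group are stated for
   submonoids of an abelian group; every commutative cancellative monoid is of
   this form up to isomorphism. *)

Section Monoids.
Context {V : nmodType}.
Implicit Types (H A : set V) (n : nat).

Definition is_submonoid H : Prop :=
  H 0 /\ forall x y, H x -> H y -> H (x + y).

Definition units H : set V := [set x | H x /\ exists2 y, H y & x + y = 0].

Definition nonunits H : set V := H `\` units H.

Definition atoms H : set V :=
  [set x | nonunits H x /\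
           ~ exists y z, [/\ nonunits H y, nonunits H z & x = y + z]].

Definition nfold_sums A n : set V :=
  [set x | exists2 y : 'I_n -> V, (forall i, A (y i)) & x = \sum_(i < n) y i].

Definition generated_monoid A : set V :=
  [set x | exists n, nfold_sums A n x].

Definition finitely_generated H : Prop :=
  exists2 A : set V, finite_set A & H = generated_monoid A.

Definition atomic H : Prop := nonunits H `<=` generated_monoid (atoms H).

Definition translate (a : V) H : set V := [set a + x | x in H].

Definition strongly_primary H : Prop :=
  H <> units H /\
  forall a, nonunits H a ->
    exists2 n, (0 < n)%N & nfold_sums (nonunits H) n `<=` translate a H.

End Monoids.

(* Only the values of f on H matter. *)
Definition monoid_hom (V W : nmodType) (H : set V) (f : V -> W) : Prop :=
  f 0 = 0 /\ forall x y, H x -> H y -> f (x + y) = f x + f y.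

Definition monoid_iso (V W : nmodType) (H : set V) (K : set W) : Prop :=
  exists2 f : V -> W, monoid_hom H f & set_bij H K f.

Section QuotientGroup.
Context {V : zmodType}.
Implicit Types (H X I : set V).

Definition quotient_group H : set V :=
  [set x | exists a b, [/\ H a, H b & x = a - b]].

Definition complete_integral_closure H : set V :=
  [set x | quotient_group H x /\
           exists2 c, H c & forall n, (0 < n)%N -> H (c + x *+ n)].

Definition completely_integrally_closed H : Prop :=
  H = complete_integral_closure H.

Definition colon H X : set V :=
  [set z | quotient_group H z /\ translate z X `<=` H].

Definition conductor H : set V := colon H (complete_integral_closure H).

Definition divisorial_ideal H I : Prop :=
  I `<=` H /\ I = colon H (colon H I).

Definition mori H : Prop :=
  forall I : nat -> set V,
    (forall n, divisorial_ideal H (I n)) ->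
    (forall n, I n `<=` I n.+1) ->
    exists n, forall m, (n <= m)%N -> I m = I n.

Definition krull H : Prop := mori H /\ completely_integrally_closed H.

End QuotientGroup.

(* The factorial monoid U x F({p_1, ..., p_s}), where the abelian group U is
   its group of units; the exponent vectors are the functions 'I_s -> nat. *)
Definition factorial_monoid (U : zmodType) (s : nat) : nmodType :=
  (U * {ffun 'I_s -> nat})%type.

Definition factorial_prime (U : zmodType) (s : nat) (i : 'I_s) :
    factorial_monoid U s :=
  (0, [ffun j => nat_of_bool (j == i)]).

(* H is a submonoid of the factorial monoid via the embedding f. *)
Definition finitely_primary (V : nmodType) (H : set V) : Prop :=
  exists (s alpha : nat) (U : zmodType) (f : V -> factorial_monoid U s),
    let p := \sum_(i < s) factorial_prime U i in
    [/\ (0 < s)%N /\ (0 < alpha)%N,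
        monoid_hom H f /\ set_inj H f,
        f @` nonunits H `<=` translate p setT
      & translate (p *+ alpha) setT `<=` f @` H].

Definition puiseux_monoid (H : set rat) : Prop :=
  is_submonoid H /\ forall x, H x -> 0 <= x.

Definition numerical_monoid (K : set nat) : Prop :=
  is_submonoid K /\ finite_set (~` K).

Definition atoms_den (H : set rat) (p : nat) : set rat :=
  [set u | atoms H u /\ (p %| `|denq u|)%N].

(* Main.v *)
(** For a Puiseux monoid [H], the complete integral closure is the nonnegative
    part of the quotient group [q(H)].  Each condition of part 1 is equivalent
    to the positive elements of [q(H)] being bounded away from [0].  If they
    are, [q(H)] is cyclic and [H] is a multiple [g K] of a numerical monoid.
    Conversely, the additive map to [nat] provided by an isomorphism or by a
    prime exponent is a scaling, an atom of the closure is its least positive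
    element, and in the Mori case a decreasing sequence of positive elements of
    [q(H)] would give an ascending chain of divisorial ideals.

    For part 2, infinitely many primes with [A_p] finite and nonempty would
    allow picking [p_1, ..., p_n] with pairwise disjoint [A_{p_i}]; the sum of
    the minima of the [A_{p_i}] then cannot be divisible by a fixed nonzero
    element of [H]. *)
Require Import Defs.
From mathcomp Require Import all_boot all_order all_algebra.
From mathcomp Require Import boolp classical_sets functions cardinality.
From mathcomp Require Import zify ring lra.

Set Implicit Arguments.
Unset Strict Implicit.
Unset Printing Implicit Defensive.

Import Order.TTheory GRing.Theory Num.Theory.
Local Open Scope classical_set_scope.
Local Open Scope ring_scope.

(** * Submonoids and generated monoids *)

Lemma submonoid_muln (V : nmodType) (H : set V) (x : V) (n : nat) :
  is_submonoid H -> H x -> H (x *+ n).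
Proof.
move=> [H0 HD] Hx; elim: n => [|n IHn]; first by rewrite mulr0n.
by rewrite mulrS; apply: HD.
Qed.

Lemma submonoid_sum (V : nmodType) (H : set V) (s : seq V) :
  is_submonoid H -> {in s, forall x, H x} -> H (\sum_(x <- s) x).
Proof.
move=> [H0 HD] Hs; rewrite big_seq_cond.
by apply: big_ind => // x /andP[xs _]; apply: Hs.
Qed.

Lemma generated_monoidP (V : nmodType) (A : set V) (x : V) :
  generated_monoid A x <->
  exists2 s : seq V, {in s, forall y, A y} & x = \sum_(y <- s) y.
Proof.
split=> [[n [y Ay ->]]|[s As ->]].
- exists [seq y i | i <- enum 'I_n]; first by move=> _ /mapP[i _ ->].
  by rewrite big_map big_enum.
- exists (size s), (tnth (in_tuple s)) => [i|]; first exact/As/mem_tnth.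
  by rewrite [LHS]big_tnth.
Qed.

Lemma generated_monoidD (V : nmodType) (A : set V) (x y : V) :
  generated_monoid A x -> generated_monoid A y -> generated_monoid A (x + y).
Proof.
move=> /generated_monoidP[s As ->] /generated_monoidP[t At ->].
apply/generated_monoidP; exists (s ++ t); last by rewrite big_cat.
by move=> z; rewrite mem_cat => /orP[/As|/At].
Qed.

Lemma generated_monoid1 (V : nmodType) (A : set V) (x : V) :
  A x -> generated_monoid A x.
Proof.
move=> Ax; apply/generated_monoidP; exists [:: x]; last by rewrite big_seq1.
by move=> y; rewrite inE => /eqP ->.
Qed.

Lemma nfold_sums_muln (V : nmodType) (A : set V) (x : V) (n : nat) :
  A x -> nfold_sums A n (x *+ n).
Proof. by move=> Ax; exists (fun=> x) => //; rewrite sumr_const card_ord. Qed.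

(** * Nonunits of Puiseux monoids and arithmetic of nonnegative rationals *)

Lemma puiseux_nonunitsP (H : set rat) (x : rat) : puiseux_monoid H ->
  nonunits H x <-> H x /\ 0 < x.
Proof.
move=> [[H0 HD] Hge]; split=> [[Hx Ux]|[Hx x0]].
- split=> //; rewrite lt0r Hge // andbT; apply/eqP => x0; apply: Ux.
  by split=> //; exists 0; rewrite // addr0.
- split=> // -[_ [y /Hge y0]]; lra.
Qed.

Lemma strongly_primary_nontrivial (H : set rat) :
  puiseux_monoid H -> strongly_primary H -> exists2 h, H h & 0 < h.
Proof.
move=> HP [HU _]; apply: contrapT => noh; apply: HU.
apply/seteqP; split=> [x Hx|x []//]; apply: contrapT => Ux; apply: noh.
by have /(puiseux_nonunitsP _ HP)[] : nonunits H x by []; exists x.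
Qed.

Lemma rat_common_multiple (x y : rat) : 0 <= x -> 0 < y ->
  exists m n : nat, (0 < m)%N /\ x *+ m = y *+ n.
Proof.
have natE (z : rat) : 0 <= z -> z *+ `|denq z|%N = `|numq z|%N%:R.
  move=> z0; rewrite -[LHS]mulr_natr !natr_absz (ger0_norm (denq_ge0 z)).
  by rewrite ger0_norm ?numq_ge0// numqE.
(* Both multiples equal the product of the two numerators. *)
move=> x0 y0; exists (`|denq x| * `|numq y|)%N, (`|denq y| * `|numq x|)%N.
split; first by rewrite muln_gt0 !absz_gt0 denq_neq0 numq_eq0 gt_eqF.
by rewrite !mulrnA (natE x x0) (natE y (ltW y0)) mulrnAC.
Qed.

Lemma rat_archimedean (x y : rat) : 0 < y -> exists n : nat, x < y *+ n.
Proof.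
move=> y0; exists (Num.trunc (x / y)).+1.
by rewrite -mulr_natl -ltr_pdivrMr// truncnS_gt.
Qed.

Lemma rat_edivn (x y : rat) : 0 <= x -> 0 < y ->
  exists (n : nat) (r : rat), [/\ x = y *+ n + r, 0 <= r & r < y].
Proof.
move=> x0 y0; have := truncn_itv (divr_ge0 x0 (ltW y0)).
set n := Num.trunc _ => /andP[n1 n2]; exists n, (x - y *+ n); split.
- by rewrite addrC subrK.
- by rewrite subr_ge0 -mulr_natl -ler_pdivlMr.
- by rewrite ltrBlDr -mulrS -mulr_natl -ltr_pdivrMr.
Qed.

(* Any two elements of a Puiseux monoid are commensurable, so an additive map
   is determined by its value at one nonzero element. *)
Lemma puiseux_hom_scaling (H : set rat) (f : rat -> nat) (x y : rat) :
  puiseux_monoid H -> monoid_hom H f -> H x -> H y ->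
  (f x)%:R * y = (f y)%:R * x.
Proof.
move=> [HM Hge] [f0 fD] Hx Hy.
have fM z n : H z -> f (z *+ n) = (f z * n)%N.
  move=> Hz; elim: n => [|n IHn]; first by rewrite mulr0n f0 muln0.
  by rewrite mulrS fD ?IHn ?mulnS//; apply: submonoid_muln.
have := Hge y Hy; rewrite le0r => /predU1P[-> | y0].
  by rewrite f0 mulr0 mul0r.
have [m [n [m0 mn]]] := rat_common_multiple (Hge x Hx) y0.
have := congr1 f mn; rewrite !fM// => /(congr1 (GRing.natmul (1 : rat))).
rewrite !natrM => fmn; move: mn; rewrite -[LHS]mulr_natr -[RHS]mulr_natr => mn.
have m1 : m%:R != 0 :> rat by rewrite pnatr_eq0 -lt0n.
by apply: (mulIf m1); rewrite -[RHS]mulrA mn mulrAC fmn; ring.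
Qed.

(** * Quotient group and complete integral closure *)

Lemma quotient_groupB (V : zmodType) (H : set V) (x y : V) : is_submonoid H ->
  quotient_group H x -> quotient_group H y -> quotient_group H (x - y).
Proof.
move=> [_ HD] [a [b [Ha Hb ->]]] [c [d [Hc Hd ->]]].
exists (a + d), (b + c); split; [exact: HD|exact: HD|].
by rewrite opprB opprD addrACA.
Qed.

Lemma quotient_groupD (V : zmodType) (H : set V) (x y : V) : is_submonoid H ->
  quotient_group H x -> quotient_group H y -> quotient_group H (x + y).
Proof.
move=> [_ HD] [a [b [Ha Hb ->]]] [c [d [Hc Hd ->]]].
exists (a + c), (b + d); split; [exact: HD|exact: HD|].
by rewrite opprD addrACA.
Qed.

Lemma sub_quotient_group (V : zmodType) (H : set V) : is_submonoid H ->
  H `<=` quotient_group H.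
Proof. by move=> [H0 _] x Hx; exists x, 0; rewrite subr0. Qed.

Lemma quotient_group_muln (V : zmodType) (H : set V) (x : V) (n : nat) :
  is_submonoid H -> quotient_group H x -> quotient_group H (x *+ n).
Proof.
move=> HM [a [b [Ha Hb ->]]]; exists (a *+ n), (b *+ n).
by rewrite mulrnBl; split=> //; apply: submonoid_muln.
Qed.

(** A negative [x] eventually makes [c + x *+ n] negative. A nonnegative [x] has a positive multiple
    in [H], so [c] only has to absorb finitely many residues. *)
Lemma puiseux_cicE (H : set rat) : puiseux_monoid H ->
  complete_integral_closure H = [set x | quotient_group H x /\ 0 <= x].
Proof.
move=> [HM Hge]; apply/seteqP; split=> x [qx].
- move=> [c Hc cx]; split=> //; rewrite leNgt; apply/negP => x0.
  have [n cn] : exists n, c < (- x) *+ n by apply: rat_archimedean; lra.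
  have := Hge _ (cx n.+1 isT); move: cn; rewrite mulNrn mulrS; lra.
- move=> x0; split=> //; have [H0 HD] := HM.
  have [a [b [Ha Hb xab]]] := qx.
  have := Hge a Ha; rewrite le0r => /predU1P[a0 | a0].
    exists 0 => // n _; have -> : x = 0 by have := Hge b Hb; lra.
    by rewrite mul0rn addr0.
  have [m [k [m0 mk]]] := rat_common_multiple x0 a0.
  (* With [m x] in [H], the element [b *+ m] absorbs the residues mod [m]. *)
  exists (b *+ m) => [|n _]; first exact: submonoid_muln.
  rewrite (divn_eq n m) mulrnDr mulnC mulrnA mk.
  have rm : (n %% m <= m)%N by rewrite ltnW// ltn_mod.
  have -> : b *+ m + (a *+ k *+ (n %/ m) + x *+ (n %% m)) =
      a *+ k *+ (n %/ m) + (b *+ (m - n %% m) + a *+ (n %% m)).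
    by rewrite xab mulrnBl mulrnBr//; ring.
  have HMn z k' : H z -> H (z *+ k') by exact: submonoid_muln.
  exact: HD (HMn _ _ (HMn _ _ Ha)) (HD _ _ (HMn _ _ Hb) (HMn _ _ Ha)).
Qed.

Lemma puiseux_cic (H : set rat) : puiseux_monoid H ->
  puiseux_monoid (complete_integral_closure H).
Proof.
move=> HP; have [HM Hge] := HP; rewrite puiseux_cicE//.
split=> [|x [] //]; split=> [|x y [qx x0] [qy y0]].
  by split=> //; apply: sub_quotient_group => //; case: HM.
by split; [apply: quotient_groupD | apply: addr_ge0].
Qed.

Lemma sub_puiseux_cic (H : set rat) : puiseux_monoid H ->
  H `<=` complete_integral_closure H.
Proof.
move=> HP x Hx; rewrite puiseux_cicE//; have [HM Hge] := HP.
by split; [apply: sub_quotient_group | apply: Hge].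
Qed.

Lemma quotient_group_cic (H : set rat) : puiseux_monoid H ->
  quotient_group (complete_integral_closure H) = quotient_group H.
Proof.
move=> HP; apply/seteqP; split=> x [a [b [Ha Hb ->]]].
- by apply: quotient_groupB; [exact: HP.1 | case: Ha | case: Hb].
- by exists a, b; split=> //; apply: sub_puiseux_cic.
Qed.

(** * Discreteness of the quotient group and numerical monoids *)

Definition quotient_gap (H : set rat) : Prop :=
  exists2 e, 0 < e & forall y, quotient_group H y -> 0 < y -> e <= y.

Lemma multiples_quotient_gap (H : set rat) (g : rat) : 0 < g ->
  (forall x, H x -> exists n : nat, x = g *+ n) -> quotient_gap H.
Proof.
move=> g0 Hg; exists g => // _ [a [b [/Hg[m ->] /Hg[n ->] ->]]].
rewrite subr_gt0 ltr_pMn2l// => nm.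
by rewrite -mulrnBr 1?ltnW// -[leLHS]mulr1n ler_pMn2l// subn_gt0.
Qed.

(** By [puiseux_hom_scaling], each [x] in [H] is [f x] times the fixed rational [h / f h]. *)
Lemma hom_quotient_gap (H : set rat) (f : rat -> nat) (h : rat) :
  puiseux_monoid H -> monoid_hom H f -> H h -> 0 < h -> (0 < f h)%N ->
  quotient_gap H.
Proof.
move=> HP fH Hh h0 fh.
have fh0 : 0 < (f h)%:R :> rat by rewrite ltr0n.
apply: (@multiples_quotient_gap _ (h / (f h)%:R)); first exact: divr_gt0.
move=> x Hx; exists (f x); rewrite -[RHS]mulr_natl mulrA.
by rewrite (puiseux_hom_scaling HP fH Hx Hh) mulrAC mulfV ?gt_eqF// mul1r.
Qed.

(** A discrete subgroup of the rationals is cyclic: a remainder modulo its least positive element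
    must vanish. *)
Lemma quotient_gap_generator (H : set rat) (h : rat) : puiseux_monoid H ->
  H h -> 0 < h -> quotient_gap H ->
  exists g, [/\ quotient_group H g, 0 < g
              & forall x, H x -> exists n : nat, x = g *+ n].
Proof.
move=> [HM Hge] Hh h0 [e e0 He].
(* Minimizing the integer part of [y / e] replaces minimizing [y]: distinct elements of the group
   differ by at least [e], so no smaller positive element shares the integer part of [g / e]. *)
pose P k := `[< exists2 y, quotient_group H y /\ 0 < y & Num.trunc (y / e) = k >].
have exP : exists k, P k.
  exists (Num.trunc (h / e)); apply/asboolP; exists h => //.
  by split=> //; apply: sub_quotient_group.
case: (ex_minnP exP) => k /asboolP[g [qg g0] gk] kmin.
exists g; split=> // x Hx.
have [n [r [xE r0 rg]]] := rat_edivn (Hge x Hx) g0.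
exists n; move: r0; rewrite le0r => /predU1P[r0 | r0].
  by rewrite xE r0 addr0.
have qr : quotient_group H r.
  have -> : r = x - g *+ n by rewrite xE addrC addKr.
  by apply: quotient_groupB => //;
    [apply: sub_quotient_group | apply: quotient_group_muln].
have er := He r qr r0.
have egr : e <= g - r by apply: He; [apply: quotient_groupB | rewrite subr_gt0].
have /kmin : P (Num.trunc (r / e)) by apply/asboolP; exists r.
have re0 : 0 <= r / e by rewrite divr_ge0 ?ltW.
have ge0 : 0 <= g / e by rewrite divr_ge0 ?ltW.
have /andP[_ ] := truncn_itv ge0; have /andP[+ _] := truncn_itv re0.
rewrite gk => rlt ltg kr.
have kr' : k%:R <= (Num.trunc (r / e))%:R :> rat by rewrite ler_nat.
have kre : k%:R * e <= r by rewrite -ler_pdivlMr//; apply: le_trans rlt.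
by move: ltg; rewrite ltr_pdivrMr// -natr1 mulrDl mul1r => ?; exfalso; lra.
Qed.

(** Writing the generator as [g = a - b] with [b = g *+ k], the monoid contains the consecutive
    multiples [k] and [k + 1] of [g], and these generate every multiple from [k * k] on. *)
Lemma quotient_gap_numerical (H : set rat) (h : rat) : puiseux_monoid H ->
  H h -> 0 < h -> quotient_gap H ->
  exists (g : rat) (K : set nat),
    [/\ 0 < g, numerical_monoid K & H = [set g *+ n | n in K]].
Proof.
move=> HP Hh h0 gapH.
have [g [[a [b [Ha Hb gab]]] g0 Hg]] := quotient_gap_generator HP Hh h0 gapH.
have [HM Hge] := HP; have [H0 HD] := HM.
exists g, [set n | H (g *+ n)]; split=> //; last first.
  apply/seteqP; split=> [x Hx|_ [n Hn <-]//].
  by have [n xn] := Hg x Hx; exists n; rewrite /= -?xn.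
split.
  split; first by rewrite /= mulr0n.
  by move=> m n /= Hm Hn; rewrite mulrnDr; apply: HD.
have [k bk] := Hg b Hb.
apply: (@sub_finite_set _ _ `I_(k * k)%N) (finite_II _) => m /= nHm.
rewrite ltnNge; apply/negP => km; apply: nHm.
(* If [k = 0] then [b = 0], and [g = a] itself lies in [H]. *)
case: (posnP k) => [k0|k0].
  have -> : g = a by rewrite gab bk k0 mulr0n subr0.
  exact: submonoid_muln.
(* [m = q k + r] with [r <= q] gives [m g = q b + r (a - b)]. *)
have rq : (m %% k <= m %/ k)%N.
  by rewrite ltnW// (leq_trans (ltn_pmod m k0))// leq_divRL.
have -> : g *+ m = b *+ (m %/ k - m %% k) + a *+ (m %% k).
  rewrite {1}(divn_eq m k) mulrnDr mulnC mulrnA -bk gab mulrnBl mulrnBr//.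
  ring.
by apply: HD; apply: submonoid_muln.
Qed.

(** * Multiples of a numerical monoid satisfy the listed conditions *)

Lemma numerical_cofinite (K : set nat) : numerical_monoid K ->
  exists N, forall n, (N <= n)%N -> K n.
Proof.
move=> [_ /finite_seqP[s Ks]]; exists (\max_(i <- s) i).+1 => n ns.
apply: contrapT => nK; have : [set` s] n by rewrite -Ks.
by move=> /= /(@leq_bigmax_seq _ _ predT id)/(_ isT); rewrite leqNgt ns.
Qed.

Lemma numerical_setT : numerical_monoid [set: nat].
Proof. by split=> //; rewrite setCT. Qed.

Lemma multiples_submonoid (V : nmodType) (g : V) (K : set nat) :
  is_submonoid K -> is_submonoid [set g *+ n | n in K].
Proof.
move=> [K0 KD]; split; first by exists 0%N; rewrite ?mulr0n.
move=> _ _ [m Km <-] [n Kn <-].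
by exists (m + n)%N; [apply: KD | rewrite mulrnDr].
Qed.

Lemma multiples_puiseux (g : rat) (K : set nat) : 0 < g -> is_submonoid K ->
  puiseux_monoid [set g *+ n | n in K].
Proof.
move=> g0 HK; split; first exact: multiples_submonoid.
by move=> _ [n _ <-]; rewrite mulrn_wge0// ltW.
Qed.

Lemma multiples_cic (g : rat) (K : set nat) : 0 < g -> numerical_monoid K ->
  complete_integral_closure [set g *+ n | n in K] =
  [set g *+ n | n in [set: nat]].
Proof.
move=> g0 HK; rewrite puiseux_cicE; last exact: multiples_puiseux HK.1.
apply/seteqP; split=> [_ [[_ [_ [[m Km <-] [n Kn <-] ->]]]]|_ [n _ <-]].
  rewrite subr_ge0 ler_pMn2l// => nm.
  by exists (m - n)%N; rewrite ?mulrnBr.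
split; last by rewrite mulrn_wge0// ltW.
have [N KN] := numerical_cofinite HK.
exists (g *+ (n + N)), (g *+ N); split; last by rewrite mulrnDr addrK.
- by exists (n + N)%N => //; apply/KN/leq_addl.
- by exists N => //; apply: KN.
Qed.

(** Elements of [K] below [2 N] suffice: a larger [n] is [N] plus [n - N], which is again at least
    [N]. *)
Lemma multiples_finitely_generated (V : nmodType) (g : V) (K : set nat) :
  numerical_monoid K -> finitely_generated [set g *+ n | n in K].
Proof.
(* The successor makes [N] positive, so that the induction descends. *)
move=> HK; have [N0 KN0] := numerical_cofinite HK; set N := N0.+1.
have KN n : (N <= n)%N -> K n by move=> Nn; apply: KN0; apply: ltnW.
pose A := [set g *+ n | n in K `&` `I_(N + N)%N].
exists A; first by apply/finite_image/finite_setIr/finite_II.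
apply/seteqP; split=> [_ [n Kn <-]|x /generated_monoidP[s As ->]]; last first.
  apply: submonoid_sum; first exact/multiples_submonoid/HK.1.
  by move=> y /As [n [Kn _] <-]; exists n.
elim/ltn_ind: n Kn => n IHn Kn; case: (ltnP n (N + N)%N) => nN.
  by apply: generated_monoid1; exists n.
have -> : n = (N + (n - N))%N by lia.
rewrite mulrnDr; apply: generated_monoidD.
  by apply: generated_monoid1; exists N => //; split; [apply: KN | rewrite /=; lia].
by apply: IHn; [lia | apply: KN; lia].
Qed.

Lemma divisorial_idealD (V : zmodType) (H I : set V) (x h : V) :
  is_submonoid H -> divisorial_ideal H I -> I x -> H h -> I (x + h).
Proof.
move=> [H0 HD] [IH II] Ix Hh; have Hxh := HD _ _ (IH _ Ix) Hh.
move: Ix; rewrite II => -[_ xI]; split.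
  by exists (x + h), 0; rewrite subr0.
move=> _ [w Iw <-]; rewrite addrAC; apply: HD => //.
by apply: xI; exists w.
Qed.

(* A nonempty ideal of [g K] misses only finitely many of the multiples of [g],
   so ascending chains of ideals stabilize. *)
Lemma multiples_mori (g : rat) (K : set nat) : numerical_monoid K ->
  mori [set g *+ n | n in K].
Proof.
move=> HK I Idiv Isub; set H := [set _ | _ in _] in Idiv.
have HM : is_submonoid H by exact/multiples_submonoid/HK.1.
have Imono m n : (m <= n)%N -> I m `<=` I n.
  elim: n => [|n IHn]; first by rewrite leqn0 => /eqP ->.
  rewrite leq_eqVlt => /predU1P[-> //|/IHn]; move/subset_trans; apply.
  exact: Isub.
case: (pselect (exists n x, I n x)) => [[n0 [x In0x]]|nI]; last first.
  by exists 0%N => m _; apply/seteqP; split=> x Ix; case: nI; eexists; eexists; exact: Ix.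
have [k _ xk] := (Idiv n0).1 _ In0x.
have [N KN] := numerical_cofinite HK; pose M := (k + N)%N.
have IM m n : (n0 <= n)%N -> (M <= m)%N -> I n (g *+ m).
  move=> n0n Mm; have -> : m = (k + (m - k))%N by lia.
  rewrite mulrnDr xk; apply: (divisorial_idealD HM (Idiv n)).
    exact: Imono In0x.
  by exists (m - k)%N => //; apply: KN; lia.
(* From [n0] on, [I n] contains all multiples from [M] on, so it is determined by the finite set
   [J n]; the chain stops where [J n] has maximal cardinality. *)
pose J n := [set i : 'I_M | `[< I n (g *+ i) >]]%SET.
have Jmono m n : (m <= n)%N -> (J m \subset J n)%SET.
  move=> mn; apply/fintype.subsetP => i; rewrite !inE => Ii.
  exact: Imono mn _ Ii.
pose P c := `[< exists2 n, (n0 <= n)%N & #|J n| = c >].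
have exP : exists c, P c by exists #|J n0|; apply/asboolP; exists n0.
have leP c : P c -> (c <= M)%N.
  by move=> /asboolP[n _ <-]; rewrite -[leqRHS]card_ord max_card.
case: (ex_maxnP exP leP) => _ /asboolP[n n0n <-] nmax.
exists n => m nm; apply/seteqP; split; last exact: Imono.
move=> y Iy; have [i _ yi] := (Idiv m).1 _ Iy; rewrite -yi in Iy *.
case: (ltnP i M) => iM; last exact: IM.
have /eqP JE : J n == J m.
  rewrite eqEcard Jmono//=; apply: nmax; apply/asboolP; exists m => //.
  exact: leq_trans nm.
have : Ordinal iM \in J m by rewrite inE; apply/asboolP.
by rewrite -JE inE => /asboolP.
Qed.

Lemma multiples_iso (g : rat) (K : set nat) : 0 < g -> is_submonoid K ->
  monoid_iso [set g *+ n | n in K] K.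
Proof.
(* Rounding makes division by [g] a map on all rationals; on multiples of [g] it is exact. *)
move=> g0 HK; pose f (x : rat) := Num.trunc (x / g).
have fK n : f (g *+ n) = n.
  by rewrite /f -[g *+ n]mulr_natr mulrC mulKf ?gt_eqF// natrK.
exists f; first split.
- by rewrite -(mulr0n g) fK.
- by move=> _ _ [m Km <-] [n Kn <-]; rewrite -mulrnDr !fK.
split.
- by move=> _ [n Kn <-]; rewrite fK.
- by move=> _ _ /set_mem[m Km <-] /set_mem[n Kn <-]; rewrite !fK => ->.
- by move=> n Kn; exists (g *+ n); [exists n | rewrite fK].
Qed.

Lemma multiples_conductor (g : rat) (K : set nat) : 0 < g ->
  numerical_monoid K -> conductor [set g *+ n | n in K] !=set0.
Proof.
move=> g0 HK; have [N KN] := numerical_cofinite HK.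
exists (g *+ N); split.
  apply: sub_quotient_group; first exact/multiples_submonoid/HK.1.
  by exists N => //; apply: KN.
move=> y [z]; rewrite multiples_cic// => -[n _ <-] <-.
by exists (N + n)%N; [apply/KN/leq_addr | rewrite mulrnDr].
Qed.

Lemma multiples_atomic (g : rat) : 0 < g ->
  atomic [set g *+ n | n in [set: nat]].
Proof.
move=> g0; set H := [set _ | _ in _].
have HP : puiseux_monoid H by apply: multiples_puiseux.
have gpos x : nonunits H x -> g <= x.
  move=> /(puiseux_nonunitsP _ HP)[[n _ <-]].
  by rewrite -{1}(mulr0n g) ltr_pMn2l// => n0; rewrite -[leLHS]mulr1n ler_pMn2l.
have ag : atoms H g.
  split; last by move=> [y [z [/gpos yg /gpos zg gyz]]]; lra.
  by apply/(puiseux_nonunitsP _ HP); split=> //; exists 1%N.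
move=> _ [[n _ <-] _]; apply/generated_monoidP; exists (nseq n g).
  by move=> y /nseqP[->].
by rewrite big_nseq -Monoid.iteropE.
Qed.

Lemma multiples_strongly_primary (g : rat) : 0 < g ->
  strongly_primary [set g *+ n | n in [set: nat]].
Proof.
move=> g0; set H := [set _ | _ in _].
have HP : puiseux_monoid H by apply: multiples_puiseux.
have Hg : H g by exists 1%N.
have gpos x : nonunits H x -> exists2 n, (0 < n)%N & x = g *+ n.
  move=> /(puiseux_nonunitsP _ HP)[[n _ <-]].
  by rewrite -{1}(mulr0n g) ltr_pMn2l// => n0; exists n.
split.
  move=> HU; have [] : nonunits H g by apply/(puiseux_nonunitsP _ HP).
  by rewrite -HU.
(* A sum of [k] positive multiples of [g] is at least [g *+ k], and the difference is a multiple of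
   [g]. *)
move=> a /gpos[k k0 ->]; exists k => // x [y Uy ->].
have /choice[z zy] : forall i, exists n, (0 < n)%N /\ y i = g *+ n.
  by move=> i; have [n] := gpos _ (Uy i); exists n.
under eq_bigr => i _ do rewrite (zy i).2.
rewrite sumrMnr; have kz : (k <= \sum_i z i)%N.
  rewrite -[leqLHS]card_ord -sum1_card; apply: leq_sum => i _.
  exact: (zy i).1.
exists (g *+ (\sum_i z i - k)); first by eexists.
by rewrite -mulrnDr subnKC.
Qed.

Lemma multiples_finitely_primary (g : rat) (K : set nat) : 0 < g ->
  numerical_monoid K -> finitely_primary [set g *+ n | n in K].
Proof.
move=> g0 HK; set H := [set _ | _ in _].
have HP : puiseux_monoid H by exact: multiples_puiseux HK.1.
have [N KN] := numerical_cofinite HK.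
have [t [t0 tD] [_ tinj tsurj]] := multiples_iso g0 HK.1.
(* One prime and the trivial unit group ['I_1]; the exponent [N.+1] is positive and lies beyond all
   gaps of [K]. *)
exists 1%N, N.+1, 'I_1, (fun x => (0, [ffun=> t x])).
have pE n : (\sum_(i < 1) factorial_prime 'I_1 i) *+ n = (0, [ffun=> n]).
  rewrite big_ord1; elim: n => [|n IHn].
    by rewrite mulr0n; congr (_, _); apply/ffunP => j; rewrite !ffunE.
  rewrite mulrS IHn; congr (_, _); first by rewrite addr0.
  by apply/ffunP => j; rewrite !ffunE !ord1 eqxx.
split=> //=.
- split; first split.
  + by congr (_, _); apply/ffunP => j; rewrite !ffunE t0.
  + move=> x y Hx Hy; congr (_, _); first by rewrite addr0.
    by apply/ffunP => j; rewrite !ffunE tD.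
  + move=> x y Hx Hy [/ffunP/(_ ord0)]; rewrite !ffunE; exact: tinj.
- move=> _ [x /(puiseux_nonunitsP _ HP)[Hx x0] <-].
  have tx : (0 < t x)%N.
    rewrite lt0n; apply/eqP => tx0; suff x00 : x = 0 by rewrite x00 ltxx in x0.
    by apply: tinj; rewrite ?inE ?tx0 ?t0//; apply: HP.1.1.
  exists (0, [ffun=> (t x).-1]) => //; rewrite -[X in X + _]mulr1n pE.
  apply: injective_projections => /=; first by rewrite addr0.
  by apply/ffunP => j; rewrite !ffunE; apply: prednK.
- move=> _ [[u z] _ <-]; rewrite pE.
  have [x Hx tx] : [set t x | x in H] (N.+1 + z ord0)%N.
    by apply: tsurj; apply: KN; lia.
  exists x => //; apply: injective_projections => /=; first by rewrite !ord1.
  by apply/ffunP => j; rewrite !ffunE tx (ord1 j).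
Qed.

(** * Each condition makes the quotient group discrete *)

Lemma rat_common_divisor (s : seq rat) : {in s, forall x, 0 <= x} ->
  exists2 d, 0 < d & {in s, forall x, exists n : nat, x = d *+ n}.
Proof.
elim: s => [|x s IHs] s0; first by exists 1.
have [y ys|d d0 ds] := IHs; first by apply: s0; rewrite inE ys orbT.
have [m [n [m0 mn]]] := rat_common_multiple (s0 x (mem_head _ _)) d0.
have dm : d = d / m%:R *+ m.
  by rewrite -[RHS]mulr_natr divfK// pnatr_eq0 -lt0n.
exists (d / m%:R); first by rewrite divr_gt0// ltr0n.
move=> y; rewrite inE => /predU1P[-> | /ds[k ->]]; last first.
  by exists (m * k)%N; rewrite mulrnA -dm.
exists n; apply: (@mulIf _ m%:R); first by rewrite pnatr_eq0 -lt0n.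
by rewrite mulr_natr mn mulrnAl divfK// pnatr_eq0 -lt0n.
Qed.

Lemma finitely_generated_gap (H : set rat) : puiseux_monoid H ->
  finitely_generated H -> quotient_gap H.
Proof.
move=> [_ Hge] [A /finite_seqP[s ->] HA].
have [y ys|d d0 ds] := @rat_common_divisor s.
  by apply: Hge; rewrite HA; apply: generated_monoid1.
apply: (multiples_quotient_gap d0) => x; rewrite HA => /generated_monoidP[t ts ->].
elim: t ts => [|y t IHt] ts; first by exists 0%N; rewrite big_nil.
have [k ->] := ds _ (ts y (mem_head _ _)).
have [z zt|n tn] := IHt; first by apply: ts; rewrite inE zt orbT.
by exists (k + n)%N; rewrite big_cons tn mulrnDr.
Qed.

Lemma iso_nat_gap (H : set rat) (K : set nat) (h : rat) : puiseux_monoid H ->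
  H h -> 0 < h -> monoid_iso H K -> quotient_gap H.
Proof.
move=> HP Hh h0 [f fH [_ finj _]]; apply: (hom_quotient_gap HP fH Hh h0).
rewrite lt0n; apply/eqP => fh; suff h00 : h = 0 by rewrite h00 ltxx in h0.
by apply: finj; rewrite ?inE// ?fh ?fH.1//; apply: HP.1.1.
Qed.

(** The exponent of one prime is an additive map to [nat], positive at [h] because nonunits are
    divisible by every prime. *)
Lemma finitely_primary_gap (H : set rat) (h : rat) : puiseux_monoid H ->
  H h -> 0 < h -> finitely_primary H -> quotient_gap H.
Proof.
move=> HP Hh h0 [s [alpha [U [f [[s0 _] [[f0 fD] _] fp _]]]]].
pose i0 := Ordinal s0.
apply: (@hom_quotient_gap _ (fun x => (f x).2 i0) h HP) => //.
  by split=> [|x y Hx Hy]; rewrite ?f0 ?fD// ffunE.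
have [|z _ <-] := fp (f h).
  by exists h => //; apply/(puiseux_nonunitsP _ HP).
rewrite /= ffunE raddf_sum/= sum_ffunE (bigD1 i0)//= ffunE eqxx.
by [].
Qed.

Lemma conductor_divisorial (H : set rat) (c : rat) : puiseux_monoid H ->
  conductor H c -> divisorial_ideal H (translate c (complete_integral_closure H)).
Proof.
move=> HP [qc cH]; split=> //; have [[H0 HD] Hge] := HP.
have HhatP := puiseux_cic HP.
apply/seteqP; split=> [_ [y yH <-]|x [qx xI]].
  split; first by apply: sub_quotient_group; [exact: HP.1 | apply: cH; exists y].
  by move=> _ [w [_ wI] <-]; rewrite addrC; apply: wI; exists (c + y) => //; exists y.
exists (x - c); last by rewrite addrC subrK.
rewrite puiseux_cicE//; split; first by apply: quotient_groupB => //; exact: HP.1.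
(* Translation by [x - c] maps the conductor to itself, and the conductor is
   bounded below. *)
have step d : conductor H d -> conductor H (d + (x - c)).
  move=> [qd dH]; have dxH y : complete_integral_closure H y ->
      H (d + (x - c) + y).
    move=> yH; have -> : d + (x - c) + y = x + (d - c + y) by ring.
    apply: xI; exists (d - c + y) => //; split.
      apply: quotient_groupD yH.1; first exact: HP.1.
      exact: quotient_groupB HP.1 qd qc.
    move=> _ [_ [z zH <-] <-]; apply: dH; exists (y + z); last by ring.
    exact: HhatP.1.2.
  split; last by move=> _ [y yH <-]; apply: dxH.
  apply: sub_quotient_group; first exact: HP.1.
  by rewrite -[_ + _]addr0; apply: dxH; apply: HhatP.1.1.
rewrite leNgt; apply/negP => xc.
have [n cn] : exists n, c < (- (x - c)) *+ n by apply: rat_archimedean; lra.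
have : conductor H (c + (x - c) *+ n).
  elim: n {cn} => [|n IHn]; first by rewrite mulr0n addr0; split.
  by rewrite mulrSr addrA; apply: step.
move=> [_ cnH]; have /cnH/Hge : translate (c + (x - c) *+ n)
    (complete_integral_closure H) (c + (x - c) *+ n).
  by exists 0; [exact: HhatP.1.1 | rewrite addr0].
by rewrite mulNrn in cn; lra.
Qed.

(* Without a gap, the principal ideals [c + r_n + cic H] for a decreasing
   sequence [r_n] in the quotient group would ascend forever. *)
Lemma mori_conductor_gap (H : set rat) : puiseux_monoid H ->
  mori H -> conductor H !=set0 -> quotient_gap H.
Proof.
move=> HP moriH [c cH]; apply: contrapT => nogap.
have /choice[next nextP] : forall e : rat, exists y : rat,
    0 < e -> [/\ quotient_group H y, 0 < y & y < e].
  move=> e; case: (pselect (0 < e)) => [e0|ne]; last by exists 0.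
  apply: contrapT => noy; apply: nogap; exists e => // y qy y0.
  by rewrite leNgt; apply/negP => ye; apply: noy; exists y.
(* At least one application of [next] discards the seed [1], which may lie outside the quotient
   group. *)
pose r n := iter n.+1 next 1.
have rP n : quotient_group H (r n) /\ 0 < r n.
  by elim: n => [|n [_ /nextP[]]//]; have [] := nextP 1 ltr01.
have rS n : r n.+1 < r n by have [] := nextP _ (rP n).2.
have HhatP := puiseux_cic HP.
have cicE x : complete_integral_closure H x <-> quotient_group H x /\ 0 <= x.
  by rewrite puiseux_cicE.
pose I n := translate (c + r n) (complete_integral_closure H).
have [||n /(_ n.+1 (leqnSn n)) In] := moriH I.
- move=> n; apply: conductor_divisorial => //; split.
    exact: quotient_groupD HP.1 cH.1 (rP n).1.
  move=> _ [y yH <-]; rewrite -addrA; apply: cH.2; eexists; last reflexivity.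
  by apply: HhatP.1.2 => //; apply/cicE; have [? /ltW] := rP n.
- move=> n _ [y /cicE[qy y0] <-]; exists (r n - r n.+1 + y); last by ring.
  apply/cicE; split; last by have := rS n; lra.
  by apply: quotient_groupD HP.1 (quotient_groupB HP.1 (rP n).1 (rP n.+1).1) qy.
have : I n.+1 (c + r n.+1) by exists 0; [exact: HhatP.1.1 | rewrite addr0].
by rewrite In => -[y /cicE[_ y0] yE]; have := rS n; lra.
Qed.

Lemma cic_quotient_gap (H : set rat) : puiseux_monoid H ->
  quotient_gap (complete_integral_closure H) -> quotient_gap H.
Proof.
by move=> HP [e e0 He]; exists e => // y; rewrite -quotient_group_cic//; apply: He.
Qed.

(** If [H] equals its closure, then [0] lies in the conductor and the Mori case applies. *)
Lemma krull_gap (H : set rat) : puiseux_monoid H -> krull H -> quotient_gap H.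
Proof.
move=> HP [moriH HE]; apply: mori_conductor_gap => //; exists 0.
rewrite /conductor -HE; split; first exact: sub_quotient_group HP.1 _ HP.1.1.
by move=> _ [y Hy <-]; rewrite add0r.
Qed.

(** An atom [g] of the closure is itself the bound: a group element [y] with [0 < y < g] would split
    it as [y + (g - y)]. *)
Lemma cic_atomic_gap (H : set rat) (h : rat) : puiseux_monoid H ->
  H h -> 0 < h -> atomic (complete_integral_closure H) -> quotient_gap H.
Proof.
move=> HP Hh h0 atH; have HhatP := puiseux_cic HP.
have : nonunits (complete_integral_closure H) h.
  by apply/(puiseux_nonunitsP _ HhatP); split=> //; apply: sub_puiseux_cic.
move=> /atH /generated_monoidP[[|g s] sA hE].
  by rewrite hE big_nil ltxx in h0.
have [/(puiseux_nonunitsP _ HhatP)[gH g0] gA] := sA g (mem_head _ _).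
exists g => // y qy y0; rewrite leNgt; apply/negP => yg; apply: gA.
exists y, (g - y); split; last by rewrite addrC subrK.
  by apply/(puiseux_nonunitsP _ HhatP); rewrite puiseux_cicE//; split=> //; split=> //; apply: ltW.
apply/(puiseux_nonunitsP _ HhatP); rewrite puiseux_cicE//.
by split; [split; [apply: quotient_groupB HP.1 gH.1 qy|] |]; lra.
Qed.

(** For a fixed [h] with exponent [n], the sum of [n] copies of [x] lies in [h + H], so [x] is at
    least [h / n]. *)
Lemma strongly_primary_bounded_below (H : set rat) : puiseux_monoid H ->
  strongly_primary H -> exists2 e, 0 < e & forall x, H x -> 0 < x -> e <= x.
Proof.
move=> HP HS; have [h Hh h0] := strongly_primary_nontrivial HP HS.
have /HS.2[n n0 hn] : nonunits H h by apply/(puiseux_nonunitsP _ HP).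
exists (h / n%:R); first by rewrite divr_gt0// ltr0n.
move=> x Hx x0; rewrite ler_pdivrMr ?ltr0n//.
have /hn[y /(HP.2)] : nfold_sums (nonunits H) n (x *+ n).
  by apply: nfold_sums_muln; apply/(puiseux_nonunitsP _ HP).
by rewrite -[x *+ n]mulr_natr => y0 <-; rewrite lerDl.
Qed.

Lemma cic_strongly_primary_gap (H : set rat) : puiseux_monoid H ->
  strongly_primary (complete_integral_closure H) -> quotient_gap H.
Proof.
move=> HP; move/(strongly_primary_bounded_below (puiseux_cic HP)) => [e e0 He].
exists e => // y qy y0; apply: He => //.
by rewrite puiseux_cicE//; split=> //; apply: ltW.
Qed.

(** * Atoms and the primes in their denominators *)

(** Nonunits are at least [e], so splitting [x] lowers each part by at least [e]; the induction is
    on a bound for [x / e]. *)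
Lemma strongly_primary_generated_atoms (H : set rat) (x : rat) :
  puiseux_monoid H -> strongly_primary H -> H x -> generated_monoid (atoms H) x.
Proof.
move=> HP HS Hx; have [e e0 He] := strongly_primary_bounded_below HP HS.
have [n xn] := rat_archimedean x e0.
elim: n x Hx xn => [|n IHn] x Hx.
  by have := HP.2 x Hx; rewrite mulr0n => ? ?; exfalso; lra.
rewrite mulrSr => xn; have := HP.2 x Hx; rewrite le0r => /predU1P[-> | x0].
  by exists 0%N, (fun=> 0) => [[]//|]; rewrite big_ord0.
case: (pselect (atoms H x)) => [xA|xA]; first exact: generated_monoid1.
have [y [z [/(puiseux_nonunitsP _ HP)[Hy y0] /(puiseux_nonunitsP _ HP)[Hz z0] xyz]]] :
    exists y z, [/\ nonunits H y, nonunits H z & x = y + z].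
  apply: contrapT => nyz; apply: xA; split=> //.
  exact/(puiseux_nonunitsP _ HP).
have ey := He y Hy y0; have ez := He z Hz z0.
by rewrite xyz; apply: generated_monoidD; apply: IHn => //; lra.
Qed.

Lemma denq_dvdn (x : rat) (m : nat) : x *+ m \is a Num.int ->
  (`|denq x| %| m)%N.
Proof.
move=> /intrP[z xm]; rewrite -(@Gauss_dvdr _ `|numq x|%N); last first.
  by rewrite coprime_sym coprime_num_den.
apply/dvdnP; exists `|z|%N; rewrite -[m]absz_nat -!abszM; congr absz.
apply/(@intr_inj rat); rewrite !rmorphM/= -xm numqE -[x *+ m]mulr_natr.
by rewrite mulrAC.
Qed.

Lemma denq_int_num (x : rat) (m : nat) : (`|denq x| %| m)%N ->
  x *+ m \is a Num.int.
Proof.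
move=> /dvdnP[k ->]; rewrite mulnC mulrnA rpredMn// -[_ *+ _]mulr_natr natr_absz.
by rewrite (ger0_norm (denq_ge0 x)) -numqE intr_int.
Qed.

(** The product of the two denominators clears [x + y], and a prime dividing neither factor does not
    divide it. *)
Lemma prime_denqD (p : nat) (x y : rat) : prime p ->
  ~~ (p %| `|denq x|)%N -> ~~ (p %| `|denq y|)%N ->
  ~~ (p %| `|denq (x + y)|)%N.
Proof.
move=> pp px py; have : ~~ (p %| `|denq x| * `|denq y|)%N.
  by rewrite Euclid_dvdM// negb_or px.
apply: contra => /dvdn_trans; apply; apply: denq_dvdn; rewrite mulrnDl rpredD// denq_int_num//.
  exact: dvdn_mulr.
exact: dvdn_mull.
Qed.

Lemma prime_denq_sum (I : Type) (r : seq I) (Q : pred I) (F : I -> rat)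
    (p : nat) : prime p -> (forall i, Q i -> ~~ (p %| `|denq (F i)|)%N) ->
  ~~ (p %| `|denq (\sum_(i <- r | Q i) F i)|)%N.
Proof.
move=> pp pF; apply: (big_ind (fun x => ~~ (p %| `|denq x|)%N)) => //.
  by rewrite dvdn1 neq_ltn prime_gt1 ?orbT.
by move=> x y; apply: prime_denqD.
Qed.

Lemma finite_set_rat_min (A : set rat) : finite_set A -> A !=set0 ->
  exists2 m, A m & forall x, A x -> m <= x.
Proof.
move=> /finite_seqP[s ->] [x /= xs]; case: s xs => // a s _ {x}.
elim: s a => [|b s IHs] a.
  by exists a; rewrite /= ?mem_head// => x; rewrite inE => /eqP ->.
have [m ms mle] := IHs b; case: (leP a m) => am.
  exists a; first exact: mem_head.
  by move=> x /=; rewrite inE => /predU1P[-> //|/mle]; apply: le_trans.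
exists m => [|x]; rewrite /= inE; first by rewrite ms orbT.
by move=> /predU1P[-> |/mle//]; apply: ltW.
Qed.

Lemma sum_sub_uniq_le (s t : seq rat) : uniq t -> {subset t <= s} ->
  {in s, forall x, 0 <= x} -> \sum_(x <- t) x <= \sum_(x <- s) x.
Proof.
elim: t s => [|x t IHt] s /=.
  by move=> _ _ s0; rewrite big_nil big_seq_cond sumr_ge0// => x /andP[/s0].
move=> /andP[xt ut] ts s0; have xs : x \in s by rewrite ts ?mem_head.
rewrite big_cons [leRHS](big_rem x xs)/= lerD2l; apply: IHt => // y yt.
  by apply: rem_mem; [apply: contraNneq xt => <- | rewrite ts ?inE ?yt ?orbT].
by apply: s0; apply: mem_rem yt.
Qed.

Lemma infinite_nat_unbounded (P : set nat) (N : nat) : infinite_set P ->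
  exists2 p, P p & (N < p)%N.
Proof.
move=> infP; apply: contrapT => noP; apply: infP.
apply: (@sub_finite_set _ _ `I_N.+1) (finite_II _) => p Pp /=.
by rewrite ltnS leqNgt; apply/negP => Np; apply: noP; exists p.
Qed.

Definition finite_den_primes (H : set rat) : set nat :=
  [set p | [/\ prime p, finite_set (atoms_den H p) & atoms_den H p !=set0]].

(** The choice is greedy: each new prime exceeds all denominators of atoms attached to the earlier
    primes, so it divides none of them. *)
Lemma separated_primes (H : set rat) (m0 : nat) :
  infinite_set (finite_den_primes H) ->
  exists p : nat -> nat,
    [/\ forall k, finite_den_primes H (p k), forall k, (m0 < p k)%N
      & forall j k u, j != k -> atoms_den H (p j) u -> ~~ (p k %| `|denq u|)%N].
Proof.
move=> infP.
have /choice[B BP] : forall p, exists b, finite_set (atoms_den H p) ->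
    forall u, atoms_den H p u -> (`|denq u| <= b)%N.
  move=> p; case: (pselect (finite_set (atoms_den H p))) => [|nfin]; last by exists 0%N.
  move=> /finite_seqP[s sE]; exists (\max_(u <- s) `|denq u|)%N => _ u.
  by rewrite sE => us; exact: (@leq_bigmax_seq _ _ predT (fun u => `|denq u|%N)).
have /choice[next nextP] : forall m, exists p, finite_den_primes H p /\ (m < p)%N.
  by move=> m; have [p] := infinite_nat_unbounded m infP; exists p.
pose m k := iter k (fun b => maxn b (B (next b))) m0.
have mmono j k : (j <= k)%N -> (m j <= m k)%N.
  elim: k => [|k IHk]; first by rewrite leqn0 => /eqP ->.
  rewrite leq_eqVlt => /predU1P[-> //|/IHk]; move/leq_trans; apply.
  exact: leq_maxl.
pose p k := next (m k); have pP k : finite_den_primes H (p k) by have [] := nextP (m k).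
have pm k : (m k < p k)%N by have [] := nextP (m k).
have sep j k u : (j < k)%N -> atoms_den H (p j) u -> ~~ (p k %| `|denq u|)%N.
  move=> jk uj; rewrite gtnNdvd ?absz_gt0 ?denq_neq0//.
  have [_ finj _] := pP j; apply: leq_ltn_trans (BP _ finj _ uj) _.
  apply: leq_ltn_trans (pm k); apply: leq_trans (mmono _ _ jk).
  exact: leq_maxr.
exists p; split=> // [k|j k u]; first exact: leq_ltn_trans (mmono 0%N k _) (pm k).
rewrite neq_ltn => /orP[jk|kj] uj; first exact: sep jk uj.
(* For [k < j], an atom with both primes in its denominator would also be attached to [p k],
   contradicting the case already settled. *)
apply/negP => uk; have [uA pju] := uj.
by have := sep k j u kj (conj uA uk); rewrite pju.
Qed.

(* Let [u k] be the smallest atom with [p k] in its denominator.  Writing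
   [\sum_k u k = h + b], every [p k] has to occur in the denominator of an atom
   of [b]; these atoms are distinct by separation, so [b >= \sum_k u k]. *)
Lemma strongly_primary_finite_den_primes (H : set rat) : puiseux_monoid H ->
  strongly_primary H -> finite_set (finite_den_primes H).
Proof.
move=> HP HS; apply: contrapT => infP.
have [h Hh h0] := strongly_primary_nontrivial HP HS.
have /HS.2[n n0 hn] : nonunits H h by apply/(puiseux_nonunitsP _ HP).
(* Primes larger than the denominator of [h] cannot divide it, so [h] never accounts for a [p k]. *)
have [p [pP hp sep]] := separated_primes `|denq h|%N infP.
have /choice[u uP] : forall k, exists u, atoms_den H (p k) u /\
    forall x, atoms_den H (p k) x -> u <= x.
  by move=> k; have [_ fink nek] := pP k; have [u] := finite_set_rat_min fink nek; exists u.
have [b Hb hb] : translate h H (\sum_(k < n) u k).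
  by apply: hn; exists u => // k; have [[[]]] := uP k.
have /generated_monoidP[s sA bE] := strongly_primary_generated_atoms HP HS Hb.
have /choice[x xP] : forall k : 'I_n, exists x, x \in s /\ atoms_den H (p k) x.
  move=> k; apply: contrapT => nox; have [pk _ _] := pP k.
  (* With [u k] isolated, [p k] would divide no denominator on the right if no atom of [b] contained
     it. *)
  have uE : u k = h + (\sum_(x <- s) x + \sum_(i < n | i != k) - u i).
    by rewrite sumrN addrA -bE hb (bigD1 k)//= addrK.
  have [[_ +] _] := uP k; apply/negP; rewrite uE.
  rewrite prime_denqD ?prime_denqD//.
  - by rewrite gtnNdvd ?absz_gt0 ?denq_neq0// hp.
  - rewrite big_seq_cond; apply: prime_denq_sum => // y /andP[ys _].
    apply/negP => pky; apply: nox; exists y; split=> //; split=> //; exact: sA.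
  - apply: prime_denq_sum => // i ik; rewrite denqN.
    by apply: sep (uP i).1.
have xinj : injective x.
  move=> i j xij; apply/eqP; apply/negPn/negP => ij.
  have := sep i j (x i) ij (xP i).2; rewrite xij.
  by have [_ [_ ->]] := xP j.
have : \sum_(y <- [seq x k | k <- enum 'I_n]) y <= \sum_(y <- s) y.
  apply: sum_sub_uniq_le.
  - by rewrite map_inj_uniq// enum_uniq.
  - by move=> _ /mapP[k _ ->]; have [] := xP k.
  - by move=> y /sA[[Hy _] _]; apply: HP.2.
rewrite big_map big_enum -bE /=.
have : \sum_(k < n) u k <= \sum_(k < n) x k.
  by apply: ler_sum => k _; apply: (uP k).2; have [] := xP k.
by rewrite -hb; lra.
Qed.

(** * Rescaling to remove the finite nonempty sets of atoms *)

Lemma scale_puiseux (H : set rat) (c : rat) : puiseux_monoid H -> 0 < c ->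
  puiseux_monoid [set c * y | y in H].
Proof.
move=> [[H0 HD] Hge] c0; split; first split.
- by exists 0; rewrite ?mulr0.
- by move=> _ _ [x Hx <-] [y Hy <-]; exists (x + y); [apply: HD | rewrite mulrDr].
- by move=> _ [x Hx <-]; apply: mulr_ge0 (ltW c0) (Hge x Hx).
Qed.

Lemma scale_atoms (H : set rat) (c : rat) : puiseux_monoid H -> 0 < c ->
  atoms [set c * y | y in H] = [set c * y | y in atoms H].
Proof.
move=> HP c0; have cHP := scale_puiseux HP c0.
have nuE x : nonunits [set c * y | y in H] (c * x) <-> nonunits H x.
  rewrite !puiseux_nonunitsP// pmulr_rgt0//.
  split=> -[Hx x0]; split=> //; last by exists x.
  by have [y Hy /(mulfI (lt0r_neq0 c0)) <-] := Hx.
apply/seteqP; split=> [w [wN wA]|_ [x [xN xA] <-]].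
  have [[x Hx wE] _] := wN; rewrite -wE in wN wA *.
  exists x => //; split; first exact/nuE.
  move=> [y [z [yN zN xE]]]; apply: wA.
  by exists (c * y), (c * z); rewrite -mulrDr -xE; split=> //; apply/nuE.
split; first exact/nuE.
move=> [y' [z' [yN zN]]].
have [[y _ yE] _] := yN; have [[z _ zE] _] := zN.
rewrite -yE -zE in yN zN *.
rewrite -mulrDr => /(mulfI (lt0r_neq0 c0)) xE; apply: xA.
by exists y, z; split=> //; apply/nuE.
Qed.

Lemma scale_iso (H : set rat) (c : rat) : 0 < c ->
  monoid_iso H [set c * y | y in H].
Proof.
move=> c0; exists (fun x => c * x).
  by split=> [|x y _ _]; rewrite ?mulr0 ?mulrDr.
split=> [x Hx|x y _ _ /(mulfI (lt0r_neq0 c0))//|_ [x Hx <-]]; last by exists x.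
by exists x.
Qed.

(* The scaling factor is the part of a common denominator supported on the
   primes [p] for which [A_p] is finite. *)
Lemma clear_finite_den_primes (H : set rat) : puiseux_monoid H ->
  finite_set (finite_den_primes H) ->
  exists Hs : set rat,
    [/\ puiseux_monoid Hs, monoid_iso H Hs
      & forall p : nat, prime p ->
          atoms_den Hs p = set0 \/ infinite_set (atoms_den Hs p)].
Proof.
move=> HP finP; set P := finite_den_primes H in finP.
have : finite_set (\bigcup_(p in P) atoms_den H p).
  by apply: bigcup_finite => // p [].
move=> /finite_seqP[s sE]; pose D := (\prod_(u <- s) `|denq u|)%N.
have D0 : (0 < D)%N.
  by rewrite prodn_gt0// => u; rewrite absz_gt0 denq_neq0.
have dD p u : P p -> atoms_den H p u -> (`|denq u| %| D)%N.
  move=> Pp uA; have us : u \in s.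
    by suff : [set` s] u by []; rewrite -sE; exists p.
  by rewrite /D (big_rem u us)/= dvdn_mulr.
pose pi : nat_pred := [pred p | `[< P p >]].
pose c := (D`_pi)%N; have c0 : 0 < c%:R :> rat by rewrite ltr0n part_gt0.
exists [set c%:R * y | y in H]; split; [exact: scale_puiseux|exact: scale_iso|].
move=> p pp; case: (pselect (P p)) => Pp.
  left; apply/seteqP; split=> // w [wA pw].
  rewrite scale_atoms// in wA; have [u uA uE] := wA.
  move: pw; rewrite -uE; apply/negP.
  case: (boolP (p %| `|denq u|)%N) => pu.
    (* Since [denq u] divides [D], the denominator of [c%:R * u] divides the cofactor of [c] in [D],
       which is prime to [p]. *)
    have : ~~ (p %| D`_pi^')%N.
      apply/negP => pD; have := pnatPpi (part_pnat pi^' D).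
      move=> /(_ p); rewrite mem_primes pp part_gt0 pD => /(_ isT).
      by rewrite !inE; apply/negP; rewrite negbK; apply/asboolP.
    apply: contra => /dvdn_trans; apply; apply: denq_dvdn.
    by rewrite mulr_natl -mulrnA partnC// denq_int_num// (dD p u).
  apply: contra pu => /dvdn_trans; apply; apply: denq_dvdn.
  by rewrite mulr_natl mulrnAC rpredMn// denq_int_num.
(* For [p] outside [P] the factor [c] is prime to [p], so scaling preserves divisibility of
   denominators by [p]. *)
have pc : ~~ (p %| c)%N.
  apply/negP => pD; have := pnatPpi (part_pnat pi D).
  move=> /(_ p); rewrite mem_primes pp part_gt0 pD => /(_ isT).
  by rewrite !inE.
have denE u : (p %| `|denq (c%:R * u)|)%N = (p %| `|denq u|)%N.
  apply/idP/idP => [/dvdn_trans|pu]; first apply.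
    by apply: denq_dvdn; rewrite mulr_natl mulrnAC rpredMn// denq_int_num.
  have : (`|denq u| %| c * `|denq (c%:R * u)|)%N.
    by apply: denq_dvdn; rewrite mulrnA -[u *+ c]mulr_natl denq_int_num.
  by move=> /(dvdn_trans pu); rewrite Euclid_dvdM// (negbTE pc).
have AE : atoms_den [set c%:R * y | y in H] p = [set c%:R * u | u in atoms_den H p].
  rewrite /atoms_den scale_atoms//; apply/seteqP; split=> [w [[u uA <-]]|].
    by rewrite denE => pu; exists u.
  by move=> w [u [uA pu] <-]; split; [exists u | rewrite denE].
case: (pselect (atoms_den H p !=set0)) => [neA|]; last first.
  by move=> /set0P/negP; rewrite negbK => /eqP A0; left; rewrite AE A0 image_set0.
right; rewrite AE => finA; apply: Pp; split=> //.
apply: sub_finite_set (finite_preimage _ finA); first exact: preimage_image.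
by move=> x y _ _; apply/mulfI/lt0r_neq0.
Qed.

Theorem theorem3p3 (H : set rat)
    (H_puiseux : puiseux_monoid H) (H_sprimary : strongly_primary H) :
  [<-> finitely_generated H;
       exists2 K : set nat, numerical_monoid K & monoid_iso H K;
       mori H /\ conductor H !=set0;
       finitely_primary H;
       krull (complete_integral_closure H);
       atomic (complete_integral_closure H);
       strongly_primary (complete_integral_closure H);
       monoid_iso (complete_integral_closure H) [set: nat]]
  /\
  (finite_set [set p : nat | [/\ prime p, finite_set (atoms_den H p)
                               & atoms_den H p !=set0]] /\
   exists Hs : set rat,
     [/\ puiseux_monoid Hs, monoid_iso H Hs
       & forall p : nat, prime p ->
           atoms_den Hs p = set0 \/ infinite_set (atoms_den Hs p)]).
Proof.
split; last first.
  have finP := strongly_primary_finite_den_primes H_puiseux H_sprimary.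
  by split=> //; apply: clear_finite_den_primes.
have [h Hh h0] := strongly_primary_nontrivial H_puiseux H_sprimary.
have HhatP := puiseux_cic H_puiseux.
have gapE := quotient_gap_numerical H_puiseux Hh h0.
(* In the cycle of implications, each hypothesis yields a gap, [H] is rewritten as the multiples of
   [g] by a numerical monoid, and the next condition is checked on that form. *)
tfae.
- move=> /(finitely_generated_gap H_puiseux)/gapE[g [K [g0 HK ->]]].
  by exists K => //; apply: multiples_iso g0 HK.1.
- move=> [K0 _ /(iso_nat_gap H_puiseux Hh h0)/gapE[g [K [g0 HK ->]]]].
  by split; [apply: multiples_mori | apply: multiples_conductor].
- move=> [moriH cH]; have [g [K [g0 HK ->]]] := gapE (mori_conductor_gap H_puiseux moriH cH).
  exact: multiples_finitely_primary.
- move=> /(finitely_primary_gap H_puiseux Hh h0)/gapE[g [K [g0 HK ->]]].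
  rewrite multiples_cic//; split; first exact/multiples_mori/numerical_setT.
  by rewrite /completely_integrally_closed multiples_cic//; apply: numerical_setT.
- move=> /(krull_gap HhatP)/(cic_quotient_gap H_puiseux)/gapE[g [K [g0 HK ->]]].
  by rewrite multiples_cic//; apply: multiples_atomic.
- move=> /(cic_atomic_gap H_puiseux Hh h0)/gapE[g [K [g0 HK ->]]].
  by rewrite multiples_cic//; apply: multiples_strongly_primary.
- move=> /(cic_strongly_primary_gap H_puiseux)/gapE[g [K [g0 HK ->]]].
  by rewrite multiples_cic//; apply: multiples_iso.
- move=> /(iso_nat_gap HhatP (sub_puiseux_cic H_puiseux Hh) h0).
  move=> /(cic_quotient_gap H_puiseux)/gapE[g [K [g0 HK ->]]].
  exact: multiples_finitely_generated.
Qed.
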